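(* Let $n\ge1$, $d\ge2$ and $1\le k\le d-1$. Let $\mathbf{p}_1,\dots,\mathbf{p}_n$ be independent uniform points in $[0,1]^d$ and let $M_{d,k}(n)$ be the number of $k$-dominant skyline points of this sample. Define \[ \beta_{d,k}:=\sum_{0\le j\le d-k}\binom{d}{j}2^{-d},\qquad I_n(x):=x\int_x^1 t^{-2}(1-t)^{n-1}\,\mathrm{d}t. \] Then \[ \mathbb{E}[M_{d,k}(n)]\ge n\,I_n(\beta_{d,k}). \]
   Context: $\mathbf{p}$ $k$-dominates $\mathbf{q}$ in $\mathbb{R}^d$ if there is a set $S$ of $k$ coordinates with $p_j\le q_j$ for all $j\in S$ and $p_j<q_j$ for some $j\in S$; a sample point is a $k$-dominant skyline point if no other sample point $k$-dominates it. *)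

(* Defs.v *)
From HB Require Import structures.
From mathcomp Require Import all_boot all_order all_algebra.
From mathcomp Require Import all_classical all_reals all_analysis.

Set Implicit Arguments.
Unset Strict Implicit.
Unset Printing Implicit Defensive.

Import Order.TTheory GRing.Theory Num.Theory.
Import numFieldNormedType.Exports.

Local Open Scope classical_set_scope.
Local Open Scope ring_scope.

(* d-dimensional Lebesgue measure: the iterated product, transported along the
   bijection (x, t) |-> x :: t from R * d.-tuple R to d.+1.-tuple R. *)
Fixpoint lebesgue_tuple (R : realType) (d : nat) :
    set (d.-tuple R) -> \bar R :=
  match d with
  | 0 => \d_([tuple] : 0.-tuple R)
  | d'.+1 => pushforward (lebesgue_measure \x @lebesgue_tuple R d')%E
               (fun xt : R * d'.-tuple R => [tuple of xt.1 :: xt.2])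
  end.

Definition unit_cube (R : realType) (d : nat) : set (d.-tuple R) :=
  [set x | forall j : 'I_d, 0 <= tnth x j <= 1].

(* No normalizing factor is needed, as the cube has volume 1. *)
Definition uniform_in_unit_cube (R : realType) (disp : measure_display)
    (T : measurableType disp) (P : probability T R) (d : nat)
    (X : {RV P >-> d.-tuple R}) : Prop :=
  forall A : set (d.-tuple R), measurable A ->
    distribution P X A = lebesgue_tuple (A `&` @unit_cube R d).

Definition mutually_independent (R : realType) (disp disp' : measure_display)
    (T : measurableType disp) (T' : measurableType disp')
    (P : probability T R) (n : nat) (X : 'I_n -> {RV P >-> T'}) : Prop :=
  forall (J : {set 'I_n}) (A : 'I_n -> set T'),
    (forall i, measurable (A i)) ->
    P (\big[setI/setT]_(i in J) (X i @^-1` A i)) =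
    (\prod_(i in J) P (X i @^-1` A i))%E.

Section skyline.
Context (R : realType) (d k n : nat).

Definition k_dominates (p q : d.-tuple R) : bool :=
  [exists S : {set 'I_d},
    [&& #|S| == k,
        [forall j in S, tnth p j <= tnth q j] &
        [exists j in S, tnth p j < tnth q j]]].

Definition k_skyline (p : 'I_n -> d.-tuple R) (i : 'I_n) : bool :=
  [forall j, (j != i) ==> ~~ k_dominates (p j) (p i)].

Definition num_k_skyline (p : 'I_n -> d.-tuple R) : nat :=
  #|[pred i | k_skyline p i]|.

End skyline.

Definition beta_coef (R : realType) (d k : nat) : R :=
  \sum_(0 <= j < (d - k).+1) 'C(d, j)%:R * 2 ^- d.

Definition I_int (R : realType) (n : nat) (x : R) : R :=
  x * \int[lebesgue_measure]_(t in `[x, 1]) (t ^- 2 * (1 - t) ^+ n.-1).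

(* Main.v *)
From HB Require Import structures.
Require Import Defs.
From mathcomp Require Import all_boot all_order all_algebra.
From mathcomp Require Import all_classical all_reals all_analysis.
From mathcomp Require Import measurable_realfun zify ring lra.

Set Implicit Arguments.
Unset Strict Implicit.
Unset Printing Implicit Defensive.

Import Order.TTheory GRing.Theory Num.Theory.
Import numFieldNormedType.Exports.

Local Open Scope classical_set_scope.
Local Open Scope ring_scope.

(** Say that y weakly dominates x when y_j <= x_j for at least k coordinates j;
    a point that no other sample point weakly dominates is a k-dominant skyline
    point.  Conditionally on p_i = x, the other points independently fail to
    dominate x weakly with probability c x each, so p_i is undominated with
    probability E[(c p_i)^(n-1)].  Comparing two uniform points coordinatewise is
    tossing d fair coins, hence E[c p_i] = 1 - beta, and by convexity of the power
    E[(c p_i)^(n-1)] >= (1 - beta)^(n-1).  This dominates I_n(beta), because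
    beta * int_beta^1 t^-2 dt = 1 - beta <= 1. *)

(** * Law of a random variable on an event *)

Section restricted_law.
Context d d' (T : measurableType d) (T' : measurableType d') (R : realType).
Variables (P : probability T R) (E : set T) (mE : measurable E).
Variable X : {mfun T >-> T'}.

(** This is the conditional law of [X] given [E] without the division by P(E), so that a null event
    [E] is no special case. It is a finite measure, hence can be a factor of a product measure. *)
Definition restricted_law : set T' -> \bar R := pushforward (mrestr P mE) X.

Let restricted_law0 : restricted_law set0 = 0%E.
Proof. exact: measure0. Qed.

Let restricted_law_ge0 A : (0 <= restricted_law A)%E.
Proof. exact: measure_ge0. Qed.

Let restricted_law_sigma_additive : semi_sigma_additive restricted_law.
Proof. exact: measure_semi_sigma_additive. Qed.

HB.instance Definition _ := isMeasure.Build _ _ _ restricted_law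
  restricted_law0 restricted_law_ge0 restricted_law_sigma_additive.

Let restricted_law_fin : fin_num_fun restricted_law.
Proof.
move=> A mA; rewrite /restricted_law /pushforward /mrestr.
apply: fin_num_measure; apply: measurableI => //.
by rewrite -[X in measurable X]setTI; exact: measurable_funP.
Qed.

HB.instance Definition _ :=
  Measure_isFinite.Build _ _ _ restricted_law restricted_law_fin.

End restricted_law.

(** * Product form of the law of a pair on an event *)

Section conditional_independence.
Local Open Scope ereal_scope.
Context d d1 d2 (T : measurableType d) (T1 : measurableType d1)
  (T2 : measurableType d2) (R : realType).

(** The hypothesis says that on rectangles the law of (Y, X) restricted to [E] is the product of [Q]
    and the restricted law of [X]. Uniqueness of the product measure extends this to every
    measurable [D], and the right-hand side is the product measure computed by sections. *)
Lemma restricted_pair_law (P : probability T R) (E : set T)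
    (mE : measurable E) (Y : {mfun T >-> T1}) (X : {mfun T >-> T2})
    (Q : probability T1 R) :
  (forall A B, measurable A -> measurable B ->
    P (Y @^-1` A `&` X @^-1` B `&` E) = Q A * P (X @^-1` B `&` E)) ->
  forall D : set (T1 * T2), measurable D ->
  P ([set w | D (Y w, X w)] `&` E) =
  \int[Q]_y P (X @^-1` xsection D y `&` E).
Proof.
move=> indep D mD.
have mYX : measurable_fun setT (fun w => (Y w, X w)).
  by apply: measurable_fun_pair.
pose YX : {mfun T >-> (T1 * T2)%type} := HB.pack (fun w => (Y w, X w))
  (isMeasurableFun.Build _ _ _ _ _ mYX).
rewrite -[LHS]/(restricted_law P mE YX D).
rewrite -(@product_measure_unique _ _ _ _ _ Q (restricted_law P mE X)) //.
Qed.

End conditional_independence.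

(** * Conditioning independent copies on one of them *)

Section independent_copies.
Local Open Scope ereal_scope.
Context d d' (T : measurableType d) (T' : measurableType d') (R : realType).

Lemma fine_probability_ge0 (Q : probability T' R) (A : set T') :
  (0 <= fine (Q A))%R.
Proof. by rewrite fine_ge0. Qed.

Lemma measurable_fine_ysection (Q : probability T' R) (C : set (T' * T')) :
  measurable C -> measurable_fun setT (fun x => fine (Q (ysection C x))).
Proof.
move=> mC; apply: measurableT_comp => //.
exact: (measurable_fun_ysection Q mC).
Qed.

Lemma measurable_prod_fine_ysection (Q : probability T' R) n (D : pred 'I_n)
    (C : 'I_n -> set (T' * T')) :
  (forall j, measurable (C j)) ->
  measurable_fun setT (fun x => (\prod_(j | D j) fine (Q (ysection (C j) x)))%R).
Proof.
move=> mC; under eq_fun do rewrite -big_filter.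
by apply: measurable_prod => j _; exact: measurable_fine_ysection.
Qed.

(** Given X_i = x, the events on the pairs (X_j, X_i) are independent, with probabilities Q(ysection
    (C j) x). A separate [C j] for each index lets one of them be replaced by a cylinder in the
    induction, and a general [B] lets the event on X_i be a section of another set. *)
Lemma independent_pair_events (P : probability T R) n
    (X : 'I_n -> {RV P >-> T'}) (Q : probability T' R) (i : 'I_n)
    (C : 'I_n -> set (T' * T')) (B : set T') :
  mutually_independent X ->
  (forall j A, measurable A -> P (X j @^-1` A) = Q A) ->
  (forall j, measurable (C j)) -> measurable B ->
  P [set w | B (X i w) /\ forall j, j != i -> C j (X j w, X i w)] =
  \int[Q]_(x in B) (\prod_(j | j != i) fine (Q (ysection (C j) x)))%:E.
Proof.
move=> indX lawX mC mB.
have mX j A : measurable A -> measurable (X j @^-1` A).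
  by move=> mA; rewrite -[X in measurable X]setTI; exact: measurable_funP.
(* The C j are cylinders A * T' outside of a list of indices, which is shortened
   by one index at a time; on cylinders the claim is the independence of X. *)
have : forall j, j \notin enum 'I_n -> j != i ->
    exists2 A, measurable A & C j = A `*` setT.
  by move=> j; rewrite mem_enum.
move: (enum 'I_n) => s; elim: s => [|j s IH] in C mC B mB *.
  move=> hC.
  have /choice[A hA] : forall j, exists A, measurable A /\
      (j != i -> C j = A `*` setT).
    move=> j; case: (eqVneq j i) => [->|ji]; first by exists setT.
    by have [A mA CA] := hC j isT ji; exists A.
  (* Index [i] carries [B], so the whole event is one intersection over all indices, to which
     independence applies directly. *)
  pose A' j := if j == i then B else A j.
  have mA' j : measurable (A' j) by rewrite /A'; case: ifP => // _; apply (hA j).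
  have -> : [set w | B (X i w) /\ (forall j, j != i -> C j (X j w, X i w))] =
      \big[setI/setT]_(j in [set: 'I_n]%SET) (X j @^-1` A' j).
    rewrite -bigcap_seq_cond; apply/seteqP; split => w /=.
      move=> [Bw Cw] j _; rewrite /A' /=.
      case: (eqVneq j i) => [->//|ji].
      by have := Cw j ji; rewrite (hA j).2// => -[].
    move=> Aw; split.
      by have := Aw i; rewrite /A' eqxx; apply; rewrite /= mem_index_enum inE.
    move=> j ji; rewrite (hA j).2//; split => //=.
      have := Aw j; rewrite /A' (negbTE ji); apply.
      by rewrite /= mem_index_enum inE.
  rewrite indX// (bigD1 i) ?inE//= {1}/A' eqxx lawX//.
  rewrite [X in Q B * X](_ : _ = (\prod_(j | j != i) fine (Q (A j)))%:E);
    last first.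
    rewrite -prodEFin; apply: eq_big => [j|j /andP[_ ji]]; first by rewrite inE.
    by rewrite /A' (negbTE ji) lawX ?fineK ?fin_num_measure//; apply (hA j).
  transitivity (\int[Q]_(x in B) (\prod_(j | j != i) fine (Q (A j)))%:E).
    by rewrite integral_cst// muleC.
  apply: eq_integral => x _; congr EFin; apply: eq_bigr => j ji.
  by rewrite (hA j).2// in_ysectionX ?inE.
move=> hC.
have [ji|ji] := eqVneq j i.
  apply: IH => // l ls li; apply: hC => //.
  by rewrite inE negb_or ls ji li.
(* [E] collects the conditions at the indices other than [i] and [j]; [h] is its conditional
   probability given X_i. *)
pose E := [set w | forall l, l != i -> l != j -> C l (X l w, X i w)].
pose h x := (\prod_(l | (l != i) && (l != j)) fine (Q (ysection (C l) x)))%R.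
have mh : measurable_fun setT h by exact: measurable_prod_fine_ysection.
have h0 x : (0 <= h x)%R by apply: prodr_ge0 => l _; exact: fine_probability_ge0.
have mE : measurable E.
  have -> : E = \big[setI/setT]_(l | (l != i) && (l != j))
      [set w | C l (X l w, X i w)].
    rewrite -bigcap_seq_cond; apply/seteqP; split => w /= Ew l.
      by case/andP=> _ /andP[li lj]; exact: Ew.
    by move=> li lj; apply: Ew; rewrite /= mem_index_enum li lj.
  apply: bigsetI_measurable => l _.
  have mXX : measurable_fun setT (fun w => (X l w, X i w)).
    exact: measurable_fun_pair.
  by rewrite -[X in measurable X]setTI; exact: mXX.
(* Replacing [C j] by the cylinder over [A] makes the induction hypothesis available. The result is
   the rectangle formula that [restricted_pair_law] asks for. *)
have IHA A D : measurable A -> measurable D ->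
    P (X j @^-1` A `&` X i @^-1` D `&` E) = Q A * \int[Q]_(x in D) (h x)%:E.
  move=> mA mD.
  pose C' l := if l == j then A `*` setT else C l.
  have mC' l : measurable (C' l).
    by rewrite /C'; case: ifP => // _; exact: measurableX.
  have := IH C' mC' D mD.
  have -> : [set w | D (X i w) /\ (forall l, l != i -> C' l (X l w, X i w))] =
      X j @^-1` A `&` X i @^-1` D `&` E.
    apply/seteqP; split => w /=.
      move=> [Dw Cw]; split; last first.
        by move=> l li lj; have := Cw l li; rewrite /C' (negbTE lj).
      by split => //; have := Cw j ji; rewrite /C' eqxx => -[].
    move=> [[Aw Dw] Ew]; split => // l li; rewrite /C'.
    by case: (eqVneq l j) => [->|lj]; [split|exact: Ew].
  move=> ->; last first.
    move=> l ls li; rewrite /C'.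
    case: (eqVneq l j) => [_|lj]; first by exists A.
    by apply: hC => //; rewrite inE negb_or lj.
  rewrite -[Q A]fineK ?fin_num_measure// -ge0_integralZl//; last 3 first.
    - by apply/measurable_EFinP; apply: measurable_funTS.
    - by move=> x _; rewrite lee_fin.
    - by rewrite lee_fin fine_probability_ge0.
  apply: eq_integral => x _; rewrite -EFinM; congr EFin.
  rewrite (bigD1 j)//= /C' eqxx in_ysectionX ?inE//; congr (_ * _)%R.
  by apply: eq_bigr => l /andP[_ lj]; rewrite (negbTE lj).
have IHT D : measurable D ->
    P (X i @^-1` D `&` E) = \int[Q]_(x in D) (h x)%:E.
  move=> mD.
  have := IHA setT D measurableT mD.
  by rewrite preimage_setT setTI probability_setT mul1e.
(* The condition [B] on X_i is absorbed into the set of pairs, so that the event becomes a condition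
   on (X_j, X_i) intersected with [E]. *)
pose D := C j `&` (setT `*` B).
have mD : measurable D by apply: measurableI => //; exact: measurableX.
have -> : [set w | B (X i w) /\ (forall l, l != i -> C l (X l w, X i w))] =
    [set w | D (X j w, X i w)] `&` E.
  apply/seteqP; split => w /=.
    by move=> [Bw Cw]; split; [split => //; exact: Cw|move=> l li _; exact: Cw].
  move=> [[Cw [_ Bw]] Ew]; split => // l li.
  by case: (eqVneq l j) => [->//|lj]; exact: Ew.
rewrite (@restricted_pair_law _ _ _ _ _ _ _ P E mE (X j) (X i) Q)//; last first.
  by move=> A F mA mF; rewrite IHA// IHT.
transitivity (\int[Q]_y \int[Q]_x ((\1_D (y, x))%:E * (h x)%:E)).
  apply: eq_integral => y _.
  rewrite IHT; last exact: measurable_xsection.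
  rewrite integral_mkcond; apply: eq_integral => x _.
  rewrite patchE indicE mem_xsection.
  by case: ifPn => _; rewrite (mul1e, mul0e).
(* With x outermost, the inner integral over y is Q(ysection D x), which for x in [B] is the factor
   of index [j] missing from [h]. *)
rewrite (fubini_tonelli (fun z : T' * T' => (\1_D z)%:E * (h z.2)%:E))/=;
  last 2 first.
  - apply: emeasurable_funM; apply/measurable_EFinP => //.
    exact: (measurableT_comp mh).
  - by move=> z; rewrite mule_ge0 ?lee_fin.
rewrite [RHS]integral_mkcond; apply: eq_integral => x _.
have mDx : measurable (ysection D x) by exact: measurable_ysection.
under eq_integral => y _.
  rewrite (_ : \1_D (y, x) = \1_(ysection D x) y); last first.
    by rewrite !indicE mem_ysection.
  over.
rewrite ge0_integralZr ?lee_fin//; last by apply/measurable_EFinP.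
rewrite integral_indic//.
rewrite setIT ysectionI patchE; case: ifPn => xB.
  rewrite in_ysectionX// setIT (bigD1 j)//= EFinM.
  by rewrite fineK// fin_num_measure//; exact: measurable_ysection.
by rewrite notin_ysectionX// setI0 measure0 mul0e.
Qed.

End independent_copies.

(** * The uniform law on the unit cube as an iterated product *)

Section cube.
Context (R : realType).

Definition pair_tuple d (xt : measurableTypeR R * d.-tuple R) : d.+1.-tuple R :=
  [tuple of xt.1 :: xt.2].

Lemma measurable_pair_tuple d : measurable_fun setT (@pair_tuple d).
Proof. by apply: measurable_cons. Qed.

HB.instance Definition _ d := isMeasurableFun.Build _ _ _ _ (@pair_tuple d)
  (@measurable_pair_tuple d).

Local Notation unif := (uniform_prob (@ltr01 R)).

(** [lebesgue_tuple] is a bare set function. This parallel construction carries the structure of a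
    probability at every dimension, and [lebesgue_tuple_cube] identifies the two on the cube. *)
Fixpoint cube_prob d : probability (d.-tuple R) R :=
  match d with
  | 0 => dirac ([tuple] : 0.-tuple R)
  | d'.+1 => distribution (unif \x cube_prob d')%E (@pair_tuple d')
  end.

Local Open Scope ereal_scope.

Lemma cube_probS d (A : set (d.+1.-tuple R)) : 
  cube_prob d.+1 A = \int[unif]_x cube_prob d [set t | A (pair_tuple (x, t))].
Proof.
rewrite /= /distribution /pushforward /product_measure1.
by apply: eq_integral => x _ /=; rewrite xsectionE.
Qed.

Lemma measurable_cons_section d (A : set (d.+1.-tuple R)) (x : R) :
  measurable A -> measurable [set t : d.-tuple R | A (pair_tuple (x, t))].
Proof.
move=> mA.
have := @measurable_xsection _ _ _ _ (@pair_tuple d @^-1` A) x.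
rewrite xsectionE; apply.
by rewrite -[X in measurable X]setTI; exact: measurable_pair_tuple.
Qed.

Lemma measurable_cube_section d (A : set (d.+1.-tuple R)) : measurable A ->
  measurable_fun setT
    (fun x => cube_prob d [set t | A (pair_tuple (x, t))]).
Proof.
move=> mA.
have mcA : measurable (@pair_tuple d @^-1` A).
  by rewrite -[X in measurable X]setTI; exact: measurable_pair_tuple.
have := measurable_fun_xsection (cube_prob d) mcA.
by congr measurable_fun; apply/funext => x /=; rewrite xsectionE.
Qed.

Lemma ge0_integral_cube_probS d (f : d.+1.-tuple R -> \bar R) :
  measurable_fun setT f -> (forall t, 0 <= f t) ->
  \int[cube_prob d.+1]_t f t =
  \int[unif]_x \int[cube_prob d]_t f (pair_tuple (x, t)).
Proof.
move=> mf f0; rewrite ge0_integral_distribution//.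
apply: (fubini_tonelli1 (f \o @pair_tuple d)) => [|xt]; last exact: f0.
exact: (measurableT_comp mf (@measurable_pair_tuple d)).
Qed.

Lemma pair_tuple0 d xt : tnth (@pair_tuple d xt) ord0 = xt.1.
Proof. by []. Qed.

Lemma pair_tupleS d xt j : tnth (@pair_tuple d xt) (lift ord0 j) = tnth xt.2 j.
Proof. exact: tnthS. Qed.

Lemma unit_cube_cons d xt :
  unit_cube (@pair_tuple d xt) <-> (0 <= xt.1 <= 1)%R /\ unit_cube xt.2.
Proof.
split=> [xtc|[x01 tc] j].
  by split=> [|j]; [exact: (xtc ord0)|rewrite -pair_tupleS; exact: xtc].
by case: (unliftP ord0 j) => [i|] ->; rewrite (pair_tuple0, pair_tupleS).
Qed.

(** Induction by slicing along the first coordinate: the uniform density is 1 on [0, 1], and a slice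
    of the cube at a coordinate outside [0, 1] is empty. *)
Lemma lebesgue_tuple_cube d (A : set (d.-tuple R)) : measurable A ->
  lebesgue_tuple (A `&` unit_cube (d:=d)) = cube_prob d A.
Proof.
elim: d => [|d IH] in A *.
  by move=> _ /=; rewrite (_ : A `&` _ = A)//; apply/setIidl => t _ [].
move=> mA.
rewrite cube_probS integral_uniform//; last exact: measurable_cube_section.
rewrite subr0 invr1 mul1e [RHS]integral_mkcond.
rewrite /= /pushforward /product_measure1; apply: eq_integral => x _ /=.
rewrite xsectionE patchE/=; case: ifPn => [|].
  rewrite inE /= in_itv/= => x01; rewrite -IH; last exact: measurable_cons_section.
  congr lebesgue_tuple; apply/seteqP; split => t /= [At].
    by move=> /(@unit_cube_cons d (x, t))[].
  by move=> tc; split => //; exact/(@unit_cube_cons d (x, t)).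
rewrite notin_setE/= in_itv/= => x01.
(* That [lebesgue_tuple] vanishes on the empty set is read off from the induction hypothesis,
   through the measure [cube_prob]. *)
transitivity (lebesgue_tuple (set0 `&` unit_cube (R:=R) (d:=d))); last first.
  by rewrite IH// measure0.
congr lebesgue_tuple.
by rewrite set0I -subset0 => t /= [_ /(@unit_cube_cons d (x, t))[]].
Qed.

End cube.

(** * Weak dominance between two uniform points *)

Section weak_dominance.
Context (R : realType).
Local Notation unif := (uniform_prob (@ltr01 R)).

Definition count_le d (y x : d.-tuple R) : nat :=
  \sum_(j < d) (tnth y j <= tnth x j)%R.

(** The dominating point is the first component, so [ysection] at x is the set of points that weakly
    dominate x. *)
Definition weakly_dominates d m : set (d.-tuple R * d.-tuple R) :=
  [set z | (m <= count_le z.1 z.2)%N].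

Lemma k_dominates_count_le d k (y x : d.-tuple R) :
  k_dominates k y x -> (k <= count_le y x)%N.
Proof.
case/existsP => S /and3P[/eqP <- /forall_inP yx _].
rewrite /count_le -sum1_card (bigID (mem S) (fun=> true))/= -[leqLHS]addn0.
by apply: leq_add => //; apply: leq_sum => j /yx ->.
Qed.

Lemma count_le_cons d (y0 x0 : R) (y x : d.-tuple R) :
  count_le (pair_tuple (y0, y)) (pair_tuple (x0, x)) =
  ((y0 <= x0)%R + count_le y x)%N.
Proof.
by rewrite /count_le big_ord_recl; under eq_bigr do rewrite !pair_tupleS.
Qed.

Lemma measurable_count_le d :
  measurable_fun setT (fun z : d.-tuple R * d.-tuple R => count_le z.1 z.2).
Proof.
have mb : measurable_fun setT nat_of_bool by [].
rewrite /count_le; move: (index_enum _) => s.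
elim: s => [|j s IH].
  by under eq_fun do rewrite big_nil; exact: measurable_cst.
under eq_fun do rewrite big_cons.
apply: measurable_fun_addn => //; apply: measurableT_comp => //.
apply: measurable_fun_ler.
- exact: (measurableT_comp (measurable_tnth j) measurable_fst).
- exact: (measurableT_comp (measurable_tnth j) measurable_snd).
Qed.

Lemma measurable_weakly_dominates d m : measurable (@weakly_dominates d m).
Proof.
rewrite -[X in measurable X]setTI.
exact: (@measurable_count_le d measurableT [set c | (m <= c)%N]).
Qed.

Lemma unif_le (x : R) : (0 <= x <= 1)%R -> unif [set y | (y <= x)%R] = x%:E.
Proof.
move=> /andP[x0 x1]; rewrite /uniform_prob integral_uniform_pdf.
rewrite (_ : [set y | _] `&` _ = `[0%R, x]%classic); last first.
  apply/seteqP; split => y /=; rewrite !in_itv/=.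
    by case=> yx /andP[-> _].
  by move=> /andP[-> yx]; split => //; exact: le_trans yx x1.
rewrite (eq_integral (cst 1%E)); last first.
  move=> y; rewrite inE/= in_itv/= => /andP[y0 yx].
  by rewrite /uniform_pdf y0 (le_trans yx x1) subr0 invr1.
rewrite integral_cst//= mul1e lebesgue_measure_itv/= lte_fin sube0.
by case: ltP => // x0'; congr EFin; apply/eqP; rewrite eq_le x0 x0'.
Qed.

Lemma measurable_unif_le :
  measurable_fun setT (fun x : R => unif [set y | (y <= x)%R]).
Proof.
have mle : measurable [set z : measurableTypeR R * measurableTypeR R | (z.1 <= z.2)%R].
  have := @measurable_fun_ler _ (measurableTypeR R * measurableTypeR R)%type R
    setT _ _ measurable_fst measurable_snd.
  by move=> /(_ measurableT [set true]); rewrite setTI; exact.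
by have := measurable_fun_ysection unif mle; congr measurable_fun; apply/funext => x /=; rewrite ysectionE.
Qed.

Lemma measurable_ray_le (x : R) : measurable [set y : R | (y <= x)%R].
Proof. by rewrite -set_itvNyc; exact: measurable_itv. Qed.

Lemma measurable_ray_gt (x : R) : measurable [set y : R | (x < y)%R].
Proof. by rewrite -set_itvoy; exact: measurable_itv. Qed.

Lemma unif_gt (x : R) :
  unif [set y | (x < y)%R] = (1 - unif [set y | (y <= x)%R])%E.
Proof.
rewrite -probability_setC.
  by congr (unif _); apply/seteqP; split => y /=; rewrite ltNge => /negP.
exact: measurable_ray_le.
Qed.

Lemma measurable_unif_gt :
  measurable_fun setT (fun x : R => unif [set y | (x < y)%R]).
Proof.
under eq_fun do rewrite unif_gt.
by apply: emeasurable_funB => //; exact: measurable_unif_le.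
Qed.

(** One face of the fair coin, the other being [integral_unif_le]: two independent uniform numbers
    fall in either order with probability 1/2. *)
Lemma integral_unif_gt : (\int[unif]_x unif [set y | (x < y)%R] = 2^-1%:E)%E.
Proof.
rewrite integral_uniform//; last first.
  exact: measurable_unif_gt.
rewrite subr0 invr1 mul1e.
(* [XMonemX 0 1] is the polynomial 1 - x, in a form whose integral is known. *)
transitivity (\int[lebesgue_measure]_(x in `[0%R, 1%R : R]) (@XMonemX R 0 1 x)%:E)%E.
  apply: eq_integral => x; rewrite inE/= in_itv/= => x01.
  by rewrite unif_gt unif_le// XMonemX0n.
rewrite -[LHS]fineK; last by apply: integrable_fin_num => //; exact: integrable_XMonemX.
rewrite -(@Rintegral_onemXn R 1); congr (fine _)%:E.
by apply: eq_integral => x _ /=; rewrite XMonemX0n.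
Qed.

Lemma integral_unif_le : (\int[unif]_x unif [set y | (y <= x)%R] = 2^-1%:E)%E.
Proof.
have : (\int[unif]_x (unif [set y | (y <= x)%R] + unif [set y | (x < y)%R]) = 1)%E.
  rewrite -[RHS](probability_setT unif) -[RHS]mul1e -integral_cst//.
  apply: eq_integral => x _; rewrite unif_gt addeC subeK//.
  by apply: fin_num_measure; exact: measurable_ray_le.
rewrite ge0_integralD//; last 2 first.
  - exact: measurable_unif_le.
  - exact: measurable_unif_gt.
rewrite integral_unif_gt => /(congr1 (fun x => x - 2^-1%:E)%E).
rewrite addeK// => ->; rewrite -EFinB; congr EFin; lra.
Qed.

Local Open Scope ereal_scope.

(** Condition on the first coordinate of the dominating point: if it is at most x0, one success
    fewer is required of the others. The truncation of [m.-1] at m = 0 is harmless, since a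
    requirement of 0 successes always holds. *)
Lemma cube_weakly_dominatesS d m (x0 : R) (x : d.-tuple R) :
  cube_prob R d.+1 (ysection (@weakly_dominates d.+1 m) (pair_tuple (x0, x))) =
  unif [set y | (y <= x0)%R] * cube_prob R d (ysection (@weakly_dominates d m.-1) x) +
  unif [set y | (x0 < y)%R] * cube_prob R d (ysection (@weakly_dominates d m) x).
Proof.
rewrite cube_probS.
transitivity (\int[unif]_y
  ((\1_[set y | (y <= x0)%R] y)%:E * cube_prob R d (ysection (@weakly_dominates d m.-1) x) +
   (\1_[set y | (x0 < y)%R] y)%:E * cube_prob R d (ysection (@weakly_dominates d m) x))).
  apply: eq_integral => y0 _; rewrite !indicE !ysectionE.
  have [yx|yx] := leP y0 x0.
    rewrite mem_set// memNset/= ?ltNge ?yx// mul1e mul0e adde0.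
    congr (cube_prob R d _); apply/seteqP; split => t;
      by rewrite /weakly_dominates /= count_le_cons yx; lia.
  rewrite memNset/= 1?leNgt ?yx// mem_set// mul1e mul0e add0e.
  congr (cube_prob R d _); apply/seteqP; split => t;
    by rewrite /weakly_dominates /= count_le_cons leNgt yx.
rewrite ge0_integralD//; last 4 first.
  - by move=> y _; rewrite mule_ge0// lee_fin.
  - apply: emeasurable_funM => //; apply/measurable_EFinP.
    by apply: measurable_indic; exact: measurable_ray_le.
  - by move=> y _; rewrite mule_ge0// lee_fin.
  - apply: emeasurable_funM => //; apply/measurable_EFinP.
    by apply: measurable_indic; exact: measurable_ray_gt.
rewrite !ge0_integralZr//; last 2 first.
  - apply/measurable_EFinP; apply: measurable_indic; exact: measurable_ray_gt.
  - apply/measurable_EFinP; apply: measurable_indic; exact: measurable_ray_le.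
rewrite !integral_indic ?setIT//;
  [exact: measurable_ray_gt|exact: measurable_ray_le].
Qed.

(** Pascal's rule summed over j; the index shift shortens the second range by one. *)
Lemma sum_binS d r :
  (\sum_(0 <= j < r.+1) 'C(d.+1, j) =
   \sum_(0 <= j < r.+1) 'C(d, j) + \sum_(0 <= j < r) 'C(d, j))%N.
Proof.
elim: r => [|r IH]; first by rewrite !big_nat1 big_geq// !bin0.
rewrite big_nat_recr//= IH binS [in RHS]big_nat_recr//= [in X in _ = (_ + X)%N]big_nat_recr//=.
lia.
Qed.

(** Tail of the binomial law with parameters d and 1/2: at least m successes means at most d - m
    failures. For m > d the truncated difference makes the sum empty, as it should be. The induction
    tosses the first coin, and the two outcomes combine by Pascal's rule. *)
Lemma integral_cube_weakly_dominates d m :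
  \int[cube_prob R d]_x cube_prob R d (ysection (@weakly_dominates d m) x) =
  ((\sum_(0 <= j < d.+1 - m) 'C(d, j))%N%:R / 2 ^+ d)%:E.
Proof.
have mG e l : measurable_fun setT (fun x : e.-tuple R =>
    cube_prob R e (ysection (@weakly_dominates e l) x)).
  by have := measurable_fun_ysection (cube_prob R e) (@measurable_weakly_dominates e l).
elim: d => [|d IH] in m *.
  rewrite /= integral_dirac//; last exact: (mG 0%N m).
  rewrite !diracE mem_set// mul1e ysectionE.
  case: m => [|m].
    by rewrite mem_set// big_nat1 bin0 divr1.
  rewrite memNset ?subSS ?sub0n ?big_geq ?mul0r//=.
  by rewrite /weakly_dominates /count_le /= big_ord0.
rewrite ge0_integral_cube_probS//.
set c := fun l => ((\sum_(0 <= j < d.+1 - l) 'C(d, j))%N%:R / 2 ^+ d)%:E : \bar R.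
have c0 l : 0 <= c l by rewrite lee_fin divr_ge0// exprn_ge0.
have mgt := measurable_unif_gt.
transitivity (\int[unif]_x0 (unif [set y | (y <= x0)%R] * c m.-1 +
                             unif [set y | (x0 < y)%R] * c m)).
  apply: eq_integral => x0 _.
  under eq_integral do rewrite cube_weakly_dominatesS.
  rewrite ge0_integralD//; last 4 first.
    - by move=> x _; exact: mule_ge0.
    - by apply: emeasurable_funM => //; exact: mG.
    - by move=> x _; exact: mule_ge0.
    - by apply: emeasurable_funM => //; exact: mG.
  rewrite ge0_integralZl//; last exact: mG.
  rewrite ge0_integralZl//; last exact: mG.
  by rewrite !IH.
rewrite ge0_integralD//; last 4 first.
  - by move=> x _; exact: mule_ge0.
  - by apply: emeasurable_funM => //; exact: measurable_unif_le.
  - by move=> x _; exact: mule_ge0.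
  - exact: emeasurable_funM.
rewrite !ge0_integralZr//; last exact: measurable_unif_le.
rewrite /c.
rewrite integral_unif_le integral_unif_gt -!EFinM -EFinD; congr EFin.
have -> : (\sum_(0 <= j < d.+2 - m) 'C(d.+1, j) = 
  \sum_(0 <= j < d.+1 - m.-1) 'C(d, j) + \sum_(0 <= j < d.+1 - m) 'C(d, j))%N.
  case: (leqP m d.+1) => md; last by rewrite !big_geq//; lia.
  rewrite subSn// sum_binS; congr addn.
  case: m md => [|m] md; last by congr bigop; rewrite /= -subSn// subSS.
  (* At m = 0 one side has an extra last term, which is the vanishing binomial coefficient of d over
     d + 1. *)
  by rewrite subn0 [in LHS]big_nat_recr//= bin_small// addn0.
rewrite natrD exprS; field.
by rewrite expf_neq0// pnatr_eq0.
Qed.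

End weak_dominance.

(** * Jensen's inequality for powers and the bound on I_n *)

Section lower_bound.
Context (R : realType).

(** The graph of t^(m+1) lies above its tangent at g, written without subtraction so that both sides
    are nonnegative. In the induction, c times the hypothesis plus the nonnegative term (m+1) g^m
    (c-g)^2 gives the claim. *)
Lemma weighted_AM_GM (c g : R) m : 0 <= c -> 0 <= g ->
  m.+1%:R * g ^+ m * c <= c ^+ m.+1 + m%:R * g ^+ m.+1.
Proof.
move=> c0 g0; elim: m => [|m IH]; first by rewrite expr0 expr1 mulr1 !mul0r mul1r addr0.
have := ler_wpM2l c0 IH.
have : 0 <= m.+1%:R * g ^+ m * (c - g) ^+ 2.
  by apply: mulr_ge0; [rewrite mulr_ge0 ?exprn_ge0|exact: sqr_ge0].
rewrite -[m.+2%:R]natr1 -[m.+1%:R]natr1 !exprS expr0.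
set a := g ^+ m; set b := c ^+ m.
lra.
Qed.

(** Jensen's inequality for a power, obtained by integrating the tangent inequality at the mean g.
    As all terms are nonnegative, the integral of the power may be infinite. *)
Lemma integral_expr_ge d (T : measurableType d) (Q : probability T R)
    (c : T -> R) (g : R) m :
  measurable_fun setT c -> (forall x, 0 <= c x) ->
  (\int[Q]_x (c x)%:E = g%:E)%E ->
  ((g ^+ m)%:E <= \int[Q]_x (c x ^+ m)%:E)%E.
Proof.
move=> mc c0 cg.
have g0 : 0 <= g.
  by rewrite -lee_fin -cg; apply: integral_ge0 => x _; rewrite lee_fin.
case: m => [|m].
  under eq_integral do rewrite expr0.
  by rewrite integral_cst//= mul1e probability_setT.
have mcm : measurable_fun setT (fun x => (c x ^+ m.+1)%:E).
  by apply/measurable_EFinP; exact: measurable_funX.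
have : (\int[Q]_x ((m.+1%:R * g ^+ m)%:E * (c x)%:E) <=
        \int[Q]_x ((c x ^+ m.+1)%:E + (m%:R * g ^+ m.+1)%:E))%E.
  apply: ge0_le_integral => //.
  - by move=> x _; rewrite lee_fin !mulr_ge0// exprn_ge0.
  - by apply: emeasurable_funM => //; apply/measurable_EFinP.
  - exact: emeasurable_funD.
  - by move=> x _; rewrite -EFinM -EFinD lee_fin weighted_AM_GM.
rewrite ge0_integralZl//; last 3 first.
  - exact/measurable_EFinP.
  - by move=> x _; rewrite lee_fin.
  - by rewrite lee_fin mulr_ge0// exprn_ge0.
rewrite cg ge0_integralD//; last 2 first.
  - by move=> x _; rewrite lee_fin exprn_ge0.
  - by move=> x _; rewrite lee_fin mulr_ge0// exprn_ge0.
rewrite integral_cst//= probability_setT mule1 -leeBlDr// -EFinM -EFinB.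
congr (_ <= _)%E; congr EFin; rewrite -natr1 exprSr; ring.
Qed.

(** The integral of a nonnegative function is a supremum over the simple functions below it, hence
    monotone. This allows a comparison with the skyline count without first proving the count
    measurable. *)
Lemma ge0_le_integral_nonmeasurable d (T : measurableType d)
    (mu : {measure set T -> \bar R}) (f1 f2 : T -> \bar R) :
  (forall x, 0 <= f1 x)%E -> (forall x, f1 x <= f2 x)%E ->
  (\int[mu]_x f1 x <= \int[mu]_x f2 x)%E.
Proof.
move=> f10 f12; rewrite !ge0_integralTE//; last first.
  by move=> x; exact: le_trans (f12 x).
apply: le_ereal_sup => _ [h hf <-]; exists h => // x.
exact: le_trans (f12 x).
Qed.

(** On [x, 1] the factor (1-t)^(n-1) is at most (1-x)^(n-1), and t^-2 has antiderivative -1/t. This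
    bounds I_n(x) by x (1/x - 1) (1-x)^(n-1), where x (1/x - 1) = 1 - x is at most 1. The endpoint x
    = 1 is separate because the fundamental theorem of calculus is applied with x < 1. *)
Lemma I_int_le n (x : R) : 0 < x <= 1 -> I_int n x <= (1 - x) ^+ n.-1.
Proof.
move=> /andP[x0]; rewrite le_eqVlt => /predU1P[->|x1].
  by rewrite /I_int set_itv1 Rintegral_set1 mulr0 exprn_ge0// subrr.
have cinvt (t : R) : x <= t -> {for t, continuous (fun t : R => t ^- 2)}.
  move=> xt; apply: (@continuousV _ _ (fun t : R => t ^+ 2)).
    by rewrite expf_neq0// gt_eqF// (lt_le_trans x0).
  exact: exprn_continuous.
have cinv : {within `[x, 1], continuous (fun t : R => t ^- 2)}.
  apply: continuous_in_subspaceT => t; rewrite inE/= in_itv/= => /andP[xt _].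
  exact: cinvt.
have cpow : {within `[x, 1], continuous (fun t : R => t ^- 2 * (1 - t) ^+ n.-1)}.
  apply: continuous_in_subspaceT => t; rewrite inE/= in_itv/= => /andP[xt _].
  apply: (@continuousM _ _ (fun t : R => t ^- 2) (fun t : R => (1 - t) ^+ n.-1)).
    exact: cinvt.
  exact: continuous_onemXn.
have iinv : lebesgue_measure.-integrable `[x, 1] (EFin \o (fun t : R => t ^- 2)).
  by apply: continuous_compact_integrable => //; exact: segment_compact.
have ipow : lebesgue_measure.-integrable `[x, 1]
    (EFin \o (fun t : R => t ^- 2 * (1 - t) ^+ n.-1)).
  by apply: continuous_compact_integrable => //; exact: segment_compact.
have Iinv : \int[lebesgue_measure]_(t in `[x, 1]) (t ^- 2) = x^-1 - 1.
  rewrite /Rintegral (@continuous_FTC2 _ _ (fun t => - t^-1))//=.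
  - by rewrite invr1 opprK addrC.
  - have dinv (t : R) : x <= t -> derivable (fun t : R => - t^-1) t 1.
      move=> xt; apply: derivableN; apply: derivableV => //.
      by rewrite gt_eqF// (lt_le_trans x0).
    have cdinv (t : R) : x <= t -> {for t, continuous (fun t : R => - t^-1)}.
      by move=> xt; apply/differentiable_continuous/derivable1_diffP/dinv.
    split.
    + by move=> t; rewrite in_itv/= => /andP[/ltW xt _]; exact: dinv.
    + by apply: cvg_at_right_filter; exact: cdinv.
    + by apply: cvg_at_left_filter; exact: cdinv (ltW x1).
  - move=> t; rewrite in_itv/= => /andP[xt _].
    have t0 : t != 0 by rewrite gt_eqF// (lt_trans x0).
    rewrite derive1E deriveN//; last exact: derivableV.
    by rewrite deriveV// derive_id scaleNr opprK scaler1.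
have x0' : x != 0 by rewrite gt_eqF.
rewrite /I_int (@le_trans _ _ (x * ((x^-1 - 1) * (1 - x) ^+ n.-1)))//.
  rewrite ler_pM2l// -Iinv -RintegralZr//.
  apply: le_Rintegral => //.
    have := @integrableZr _ _ _ _ _ _ ((1 - x) ^+ n.-1) _ iinv.
    by apply; exact: measurable_itv.
  move=> t; rewrite /= in_itv/= => /andP[xt t1].
  rewrite ler_wpM2l ?invr_ge0 ?exprn_ge0 ?(le_trans (ltW x0))//.
  by rewrite lerXn2r ?nnegrE ?subr_ge0 ?lerD2l ?lerN2// ltW.
rewrite mulrA mulrBr mulfV// mulr1 ler_piMl//.
  by rewrite exprn_ge0// subr_ge0 ltW.
by rewrite gerBl ltW.
Qed.

Lemma beta_coefE d k : (k <= d)%N ->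
  beta_coef R d k = (\sum_(0 <= j < d.+1 - k) 'C(d, j))%N%:R / 2 ^+ d.
Proof.
by move=> kd; rewrite /beta_coef subSn// natr_sum mulr_suml.
Qed.

Lemma beta_coef_gt0 d k : 0 < beta_coef R d k.
Proof.
rewrite /beta_coef big_nat_recl// bin0 mul1r ltr_wpDr ?invr_gt0 ?exprn_gt0//.
by apply: sumr_ge0 => j _; rewrite mulr_ge0 ?invr_ge0 ?exprn_ge0.
Qed.

End lower_bound.

(** * Probability of being undominated, and the bound on the expected skyline *)

Lemma integral_cube_not_weakly_dominates (R : realType) d k : (k <= d)%N ->
  (\int[cube_prob R d]_x (fine (cube_prob R d
     (ysection (~` @weakly_dominates R d k) x)))%:E = (1 - beta_coef R d k)%:E)%E.
Proof.
move=> kd; set Q := cube_prob R d; set W := @weakly_dominates R d k.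
have mW : measurable W by exact: measurable_weakly_dominates.
have mQW : measurable_fun setT (fun x => Q (ysection W x)).
  by have := measurable_fun_ysection Q mW.
have mQWc : measurable_fun setT (fun x => Q (ysection (~` W) x)).
  by have := measurable_fun_ysection Q (measurableC mW).
under eq_integral.
  move=> x _; rewrite fineK; last first.
    by apply: fin_num_measure; apply: measurable_ysection; exact: measurableC.
  over.
(* Additivity is applied to two nonnegative integrands summing to 1; the known finite value is then
   subtracted. *)
have : (\int[Q]_x (Q (ysection W x) + Q (ysection (~` W) x)) = 1)%E.
  rewrite -[RHS](probability_setT Q) -[RHS]mul1e -integral_cst//.
  apply: eq_integral => x _; rewrite (_ : ysection (~` W) x = ~` ysection W x).
    rewrite probability_setC; last exact: measurable_ysection.
    rewrite addeC subeK//; apply: fin_num_measure; exact: measurable_ysection.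
  by rewrite !ysectionE.
rewrite ge0_integralD// integral_cube_weakly_dominates -beta_coefE//.
by move=> /(congr1 (fun x => x - (beta_coef R d k)%:E)%E); rewrite addeC addeK.
Qed.

Theorem theorem10 (R : realType) (n d k : nat)
    (n_ge1 : (1 <= n)%N) (d_ge2 : (2 <= d)%N) (k_bounds : (1 <= k <= d - 1)%N)
    (disp : measure_display) (T : measurableType disp) (P : probability T R)
    (p : 'I_n -> {RV P >-> d.-tuple R})
    (p_uniform : forall i : 'I_n, uniform_in_unit_cube (p i))
    (p_independent : mutually_independent p) :
  ((n%:R * I_int n (beta_coef R d k))%:E <=
   'E_P[fun w : T => (num_k_skyline k (fun i : 'I_n => p i w))%:R])%E.
Proof.
have kd : (k <= d)%N by lia.
set b := beta_coef R d k.
pose Q := cube_prob R d.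
pose C : set (d.-tuple R * d.-tuple R) := ~` @weakly_dominates R d k.
have mC : measurable C by apply: measurableC; exact: measurable_weakly_dominates.
pose c x := fine (Q (ysection C x)).
have c0 x : 0 <= c x by exact: fine_probability_ge0.
have mc : measurable_fun setT c by exact: measurable_fine_ysection.
have intc : (\int[Q]_x (c x)%:E = (1 - b)%:E)%E.
  exact: integral_cube_not_weakly_dominates.
(* The upper bound comes from 1 - b being the integral of a nonnegative function. *)
have b1 : 0 < b <= 1.
  rewrite beta_coef_gt0 -subr_ge0 -lee_fin -intc.
  by apply: integral_ge0 => x _; rewrite lee_fin.
(* No other point weakly dominates p_i on [E i]. The trivial first conjunct matches the form of
   [independent_pair_events], with [B] the full set. *)
pose E i := [set w | [set: d.-tuple R] (p i w) /\
  forall j, j != i -> C (p j w, p i w)].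
have mE i : measurable (E i).
  have -> : E i = \big[setI/setT]_(j | j != i) [set w | C (p j w, p i w)].
    rewrite -bigcap_seq_cond; apply/seteqP; split => w /=.
      by move=> [_ Ew] j /andP[_]; exact: Ew.
    by move=> Ew; split => // j ji; apply: Ew; rewrite /= mem_index_enum ji.
  apply: bigsetI_measurable => j _.
  have mpp : measurable_fun setT (fun w => (p j w, p i w)).
    exact: measurable_fun_pair.
  by rewrite -[X in measurable X]setTI; exact: mpp.
have PE i : (((1 - b) ^+ n.-1)%:E <= P (E i))%E.
  rewrite (@independent_pair_events _ _ _ _ _ _ _ _ Q _ (fun=> C))//; last first.
    by move=> j A mA; rewrite -lebesgue_tuple_cube//; exact: (p_uniform j A mA).
  under eq_integral.
    move=> x _; rewrite prodr_const (_ : #|_| = n.-1); last first.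
      by rewrite (cardC1 i) card_ord.
    over.
  exact: integral_expr_ge.
rewrite unlock.
(* The number of weakly undominated points is a measurable lower bound for the skyline count, and
   its expectation is a sum of probabilities. *)
apply: (@le_trans _ _ (\int[P]_w \sum_(i < n) (\1_(E i) w)%:E)%E); last first.
  apply: ge0_le_integral_nonmeasurable => w.
    by apply: sume_ge0 => i _; rewrite lee_fin.
  rewrite sumEFin lee_fin /num_k_skyline -sum1_card natr_sum [leRHS]big_mkcond/=.
  apply: ler_sum => i _; rewrite indicE; case: (boolP (w \in E i)) => [|_].
    rewrite inE => -[_ Ew]; rewrite inE ifT//.
    apply/forallP => j; apply/implyP => ji; apply/negP => /k_dominates_count_le.
    exact: Ew ji.
  by case: ifP.
rewrite ge0_integral_sum//; last first.
  by move=> i; apply/measurable_EFinP.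
apply: (@le_trans _ _ (\sum_(i < n) ((1 - b) ^+ n.-1)%:E)%E).
  rewrite sumEFin lee_fin sumr_const card_ord mulr_natl lerMn2r.
  by rewrite I_int_le ?orbT.
by apply: lee_sum => i _; rewrite integral_indic// setIT; exact: PE.
Qed.
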